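(* Let $n\ge 1$ and let $X_1,\dots,X_n$ be non-empty sets. A set $S\subset X_1\times X_2\times\cdots\times X_n$ is good if and only if $S$ contains no loop (that is, no finite subset of $S$ is a loop).
   Context: A set $S\subset X_1\times\cdots\times X_n$ is good if every function $f:S\to\mathbb{R}$ can be written as $f(x_1,\dots,x_n)=u_1(x_1)+\cdots+u_n(x_n)$ for all $(x_1,\dots,x_n)\in S$, for some functions $u_i:X_i\to\mathbb{R}$. A finite non-empty set $L=\{\underline{x}^1,\dots,\underline{x}^k\}$ of $k$ distinct points in $X_1\times\cdots\times X_n$, with $\underline{x}^j=(x^j_1,\dots,x^j_n)$, is a loop if: (i) there exist non-zero integers $p_1,\dots,p_k$ such that for each $i$, $1\le i\le n$, $\sum_{j=1}^k p_j\mathbf{1}_{\{x_i^{j}\}}=0$ as a function on $X_i$; and (ii) no non-empty proper subset of $L$ satisfies the condition in (i) (with its own non-zero integers). *)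

(* Defs.v *)
From HB Require Import structures.
From mathcomp Require Import all_boot all_order all_algebra.
From mathcomp Require Import boolp classical_sets reals numfun.

Set Implicit Arguments.
Unset Strict Implicit.
Unset Printing Implicit Defensive.

Import Order.TTheory GRing.Theory Num.Theory.
Local Open Scope classical_set_scope.
Local Open Scope ring_scope.

Section Defs.
Variables (n : nat) (X : 'I_n -> Type).

(* [f : S -> R] is a function on the subtype of elements of [S]. *)
Definition good (R : realType) (S : set (forall i, X i)) : Prop :=
  forall f : S -> R, exists u : forall i, X i -> R,
    forall x : S, f x = \sum_(i < n) u i (val x i).

(* The existence of an enumeration [x] makes [L] finite. The index type ['I_k]
   may be empty here, so [loop] requires non-emptiness separately. *)
Definition balanced (L : set (forall i, X i)) : Prop :=
  exists k (x : 'I_k -> forall i, X i) (p : 'I_k -> int),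
    [/\ injective x, range x = L, forall j, p j != 0 &
        forall i (y : X i), \sum_(j < k) p j * \1_[set x j i] y = 0].

Definition loop (L : set (forall i, X i)) : Prop :=
  [/\ L !=set0, balanced L &
      forall M, M !=set0 -> M `<` L -> ~ balanced M].

End Defs.

(* Main.v *)
Require Import Defs.
From HB Require Import structures.
From mathcomp Require Import all_boot all_order all_algebra.
From mathcomp Require Import boolp classical_sets functions reals numfun.

Set Implicit Arguments.
Unset Strict Implicit.
Unset Printing Implicit Defensive.

Import Order.TTheory GRing.Theory Num.Theory.
Local Open Scope classical_set_scope.
Local Open Scope ring_scope.

(* [S] is good exactly when the vectors (delta_(1,x_1) + ... + delta_(n,x_n)), for
   x in S, are linearly independent over R: independence lets the values f(x) be
   prescribed for a linear functional u, whose restriction to the delta_(i,y) gives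
   the u_i. A real dependence is a left kernel vector of a 0/1 matrix, whose rank is
   the same over the rationals, so it can be replaced by an integer one; a balanced
   set of least cardinality is then a loop. *)

(** Zorn gives a maximal subspace [M] containing [A] and missing [e]. Maximality makes it a
    complement of the line through [e], and [h] reads off the coefficient along [e]. *)
Lemma separating_functional (F : fieldType) (V : lmodType F) (A : set V) (e : V) :
    A 0 -> (forall a u v, A u -> A v -> A (a *: u + v)) -> ~ A e ->
  exists h : {scalar V}, h e = 1 /\ forall v, A v -> h v = 0.
Proof.
move=> A0 Alin Ae.
(* Zorn also considers the empty chain, so the union may be empty: [P] only asks
   nonempty sets to contain [A]. *)
pose P (B : set V) := [/\ forall a u v, B u -> B v -> B (a *: u + v),
  ~ B e & forall u, B u -> A `<=` B].
have [C FP tot|M [[Mlin Me MA] Mmax]] := @Zorn_bigcup V P.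
  split=> [a u v [B CB Bu] [B' CB' Bv]|[B CB Be]|u [B CB Bu] v Av].
  - have [BB'|B'B] := tot _ _ CB CB'.
      by exists B' => //; have [+ _ _] := FP _ CB'; apply=> //; exact: BB'.
    by exists B => //; have [+ _ _] := FP _ CB; apply=> //; exact: B'B.
  - by have [_ + _] := FP _ CB; apply.
  - by exists B => //; have [_ _ /(_ _ Bu)] := FP _ CB; exact.
have AM : A `<=` M.
  have [[u /MA//]|M0] := pselect (exists u, M u).
  have MA' : M `<` A.
    by split=> [u Mu|/(_ _ A0) Mz]; case: M0; [exists u|exists 0].
  by exfalso; apply: (Mmax A MA'); split=> // u _ v.
have M0 := AM _ A0.
have Ms a u : M u -> M (a *: u) by move=> Mu; rewrite -[_ *: _]addr0; exact: Mlin.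
(* Otherwise adjoin [v] to [M]: by maximality the larger subspace contains [e], so [e - t *: v] lies
   in [M], with [t] nonzero because [e] is not in [M]. Dividing by [- t] contradicts the choice of
   [v]. *)
have ex v : exists t, M (v - t *: e).
  apply: contrapT => /forallNP vM.
  have vNM : ~ M v by move: (vM 0); rewrite scale0r subr0.
  pose M' := [set w | exists t, M (w - t *: v)].
  have M'v : M' v by exists 1; rewrite scale1r subrr.
  have MM' : M `<=` M' by move=> w Mw; exists 0; rewrite scale0r subr0.
  apply: (Mmax M'); first by split=> // /(_ _ M'v).
  split=> [a w w' [t Mt] [t' Mt']|[t Mt]|_ _]; last exact: subset_trans MM'.
    exists (a * t + t'); have := Mlin a _ _ Mt Mt'.
    by rewrite scalerBr scalerA addrACA -opprD -scalerDl.
  have [t0|t0] := eqVneq t 0; first by move: Mt; rewrite t0 scale0r subr0.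
  apply: (vM t^-1); have := Ms (- t^-1) _ Mt.
  by rewrite scalerBr !scaleNr scalerA mulVf// scale1r opprK addrC.
have uniq v t t' : M (v - t *: e) -> M (v - t' *: e) -> t = t'.
  move=> Mt /(Mlin (-1) _ _)/(_ Mt); rewrite scaleN1r opprB subrKA -scalerBl.
  move=> /(Ms (t' - t)^-1).
  have [/eqP|tt'] := eqVneq (t' - t) 0; first by rewrite subr_eq0 => /eqP.
  by rewrite scalerA mulVf// scale1r => /Me.
have [h hP] := choice ex.
have hlin : linear_for *%R h.
  move=> a u v; apply: (uniq (a *: u + v)); first exact: hP.
  have := Mlin a _ _ (hP u) (hP v).
  by rewrite scalerBr scalerA addrACA -opprD -scalerDl.
pose hL := GRing.isLinear.Build _ _ _ _ _ hlin.
exists (HB.pack_for {scalar V} h hL); split=> /= [|v Av].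
  by apply: (uniq e); [exact: hP|rewrite scale1r subrr].
by apply: (uniq v); [exact: hP|rewrite scale0r subr0; exact: AM].
Qed.

(** Repeated points of a formal combination are merged by adding their coefficients. This serves
    both for the values of one coordinate and for the points of [S]. *)
Lemma collect_fibers (R : pzRingType) (T : Type) (r : seq (R * T)) :
  exists m (y : 'I_m -> T),
    [/\ injective y, forall l, exists i, y l = (tnth (in_tuple r) i).2 &
    forall (V : lmodType R) (g : T -> V), \sum_(z <- r) z.1 *: g z.2 =
      \sum_(l < m) (\sum_(z <- r) z.1 * \1_[set z.2] (y l)) *: g (y l)].
Proof.
pose s : seq {classic T} := undup ([seq z.2 | z <- r] : seq {classic T}).
have us : uniq s by exact: undup_uniq.
exists (size s), (tnth (in_tuple s)); split=> [|l|V g].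
- exact/(tuple_uniqP (in_tuple s)).
- have : tnth (in_tuple s) l \in s by exact: mem_tnth.
  rewrite mem_undup => /(nthP (tnth (in_tuple s) l))[i]; rewrite size_map => ir <-.
  exists (Ordinal ir); rewrite (nth_map (0, tnth (in_tuple s) l))//.
  by rewrite (tnth_nth (0, tnth (in_tuple s) l)).
transitivity (\sum_(y <- s) (\sum_(z <- r) z.1 * \1_[set z.2] y) *: g y); last first.
  by rewrite big_tnth.
under [RHS]eq_bigr do rewrite scaler_suml.
rewrite exchange_big/= [LHS]big_tnth [RHS]big_tnth; apply: eq_bigr => i _.
set z := tnth _ i; have zs : (z.2 : {classic T}) \in s.
  rewrite mem_undup; apply: (@map_f (R * {classic T})%type {classic T} snd).
  exact: (mem_tnth i (in_tuple (r : seq (R * {classic T})))).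
rewrite (bigD1_seq (z.2 : {classic T}))//= big1_seq ?addr0 => [|y /andP[yz _]].
  by rewrite indicE mem_set// mulr1.
by rewrite indicE memNset ?mulr0 ?scale0r// => yz'; case/eqP: yz.
Qed.

Lemma integer_left_kernel (R : numFieldType) (k m : nat)
    (A : 'M[rat]_(k, m)) (c : 'rV[R]_k) :
    c != 0 -> c *m map_mx ratr A = 0 ->
  exists2 p : 'rV[int]_k, p != 0 & map_mx intr p *m A = 0.
Proof.
move=> c0 cA.
have nfA : ~~ row_free A.
  rewrite -(row_free_map (ratr : {rmorphism rat -> R})); apply: contra c0 => fA.
  by apply/eqP; apply: (row_free_inj fA); rewrite cA mul0mx.
have [q qA q0] : exists2 q : 'rV[rat]_k, q *m A = 0 & q != 0.
  by move: nfA; rewrite -kermx_eq0 => /rowV0Pn[q /sub_kermxP]; exists q.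
pose d := \prod_j denq (q 0 j).
have d0 : d != 0 by apply/prodf_neq0 => j _; exact: denq_neq0.
(* This is [d *: q] written with integers: each numerator is multiplied by all the other
   denominators. *)
pose p := \row_j (numq (q 0 j) * \prod_(i | i != j) denq (q 0 i)).
have pq : map_mx intr p = d%:~R *: q.
  apply/rowP => j; rewrite !mxE intrM numqE /d [in RHS](bigD1 j)//= intrM.
  by rewrite [RHS]mulrAC [q 0 j * _]mulrC.
exists p; last by rewrite pq -scalemxAl qA scaler0.
apply: contra q0 => /eqP p0; move: pq; rewrite p0 map_mx0 => /esym/eqP.
by rewrite scaler_eq0 intr_eq0 (negPf d0).
Qed.

(** An integer kernel vector may have zero entries, while [balanced] demands nonzero weights. Hence
    only the points in its support are kept, and [M] may be smaller than [range x]. *)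
Lemma balanced_of_dependence (R : numFieldType) (n : nat) (X : 'I_n -> Type) (k : nat)
    (x : 'I_k -> forall i, X i) (c : 'I_k -> R) (j0 : 'I_k) :
    injective x -> c j0 != 0 ->
    (forall i (y : X i), \sum_(j < k) c j * \1_[set x j i] y = 0) ->
  exists M : set (forall i, X i), [/\ M !=set0, M `<=` range x & balanced M].
Proof.
move=> xinj cj0 cx.
pose I := ('I_n * 'I_k)%type.
(* The columns only need the pairs (i, y) with y the i-th coordinate of some x j'. *)
pose A : 'M[rat]_(k, #|{: I}|) := \matrix_(j, l)
  \1_[set x j (enum_val l).1] (x (enum_val l).2 (enum_val l).1).
have [||p p0 pA] := @integer_left_kernel R k _ A (\row_j c j).
- by apply: contra cj0 => /eqP/rowP/(_ j0); rewrite !mxE => ->.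
- apply/rowP => l; rewrite !mxE -[RHS](cx _ (x (enum_val l).2 (enum_val l).1)).
  by apply: eq_bigr => j _; rewrite !mxE !indicE ratr_nat.
have px i (y : X i) : \sum_j p 0 j * \1_[set x j i] y = 0.
  have [[j <-]|yx] := pselect (exists j, x j i = y); last first.
    rewrite big1// => j _; rewrite indicE memNset ?mulr0// => xy.
    by apply: yx; exists j.
  have /rowP/(_ (enum_rank ((i, j) : I))) := pA; rewrite !mxE => pA0.
  apply/eqP; rewrite -(intr_eq0 rat) -[X in _ == X]pA0 rmorph_sum/=.
  apply/eqP; apply: eq_bigr => j' _.
  by rewrite !mxE !indicE enum_rankK rmorphM/= rmorph_nat.
pose D := [pred j | p 0 j != 0].
have /rV0Pn[j1 pj1] := p0.
exists (range (fun l : 'I_#|D| => x (enum_val l))); split.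
- by exists (x j1), (enum_rank_in (pj1 : j1 \in D) j1) => //; rewrite enum_rankK_in.
- by move=> _ [l _ <-]; exists (enum_val l).
exists #|D|, (fun l => x (enum_val l)), (fun l => p 0 (enum_val l)); split=> //.
- by move=> l l' /xinj/enum_val_inj.
- by move=> l; have := enum_valP l; rewrite inE.
move=> i y; rewrite -(big_enum_val (A := D) (fun j => p 0 j * \1_[set x j i] y)).
rewrite -[RHS](px i y) big_mkcond/=; apply: eq_bigr => j _.
by rewrite inE; case: eqP => //= ->; rewrite mul0r.
Qed.

Lemma card_range_proper (T : Type) (k m : nat) (x : 'I_k -> T) (y : 'I_m -> T) :
  injective y -> range y `<` range x -> (m < k)%N.
Proof.
move=> yinj [yx /existsNP[_ /not_implyP[[l _ <-] yl]]].
have /choice[g xg] j : exists i, x i = y j.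
  by have [|i _ <-] := yx (y j); [exists j|exists i].
have ginj : injective g by move=> j j' gjj; apply: yinj; rewrite -!xg gjj.
(* If [k <= m], the injection [g] is onto, so the missed point [x l] would lie in [range y]. *)
rewrite ltnNge; apply/negP => km.
have [|h _ gh] := @inj_card_bij _ _ g ginj; first by rewrite !card_ord.
by apply: yl; exists (h l) => //; rewrite -xg gh.
Qed.

Lemma loop_of_balanced (n : nat) (X : 'I_n -> Type) (L : set (forall i, X i)) :
  L !=set0 -> balanced L -> exists2 M, M `<=` L & loop M.
Proof.
move=> L0 [k]; elim/ltn_ind: k L L0 => k IH L L0 [x [p [xinj xL p0 px]]].
have [Lmin|] := pselect (forall M, M !=set0 -> M `<` L -> ~ balanced M).
  by exists L => //; split=> //; exists k, x, p.
move=> /existsNP[M /not_implyP[M0 /not_implyP[ML /contrapT[m [y [q [yinj yM q0 qy]]]]]]].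
have mk : (m < k)%N by apply: (card_range_proper (x := x) yinj); rewrite yM xL.
have [|N NM Nloop] := IH m mk M M0; first by exists y, q.
by exists N => //; apply: subset_trans NM _; case: ML.
Qed.

(** The weights [p] of a loop annihilate every sum of functions of one coordinate, but not the
    indicator of the single point [x j0]. *)
Lemma loop_not_good (R : realType) (n : nat) (X : 'I_n -> Type)
    (S L : set (forall i, X i)) : L `<=` S -> loop L -> ~ good R S.
Proof.
move=> LS [[z Lz] [k [x [p [xinj xL p0 px]]]] _] gS.
have [j0 _ _] : range x z by rewrite xL.
have xS j : x j \in S by apply/mem_set/LS; rewrite -xL; exists j.
have [u fu] := gS (fun z => \1_[set x j0] (val z)).
have pu i : \sum_j (p j)%:~R * u i (x j i) = 0 :> R.
  (* Grouping the points by their [i]-th coordinate turns the coefficient of each value [y l] into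
     the balance sum at [y l]. *)
  pose r := [seq ((p j)%:~R : R, x j i) | j <- index_enum 'I_k].
  have [m [y [_ _ /(_ R^o (u i))]]] := collect_fibers r.
  rewrite big_map => ->; apply: big1 => l _.
  rewrite big_map [X in X *: _](_ : _ = (\sum_j p j * \1_[set x j i] (y l))%:~R).
    by rewrite px scale0r.
  by rewrite rmorph_sum; apply: eq_bigr => j _; rewrite !indicE rmorphM/= rmorph_nat.
have : \sum_j (p j)%:~R * \1_[set x j0] (x j) = 0 :> R.
  transitivity (\sum_j \sum_i (p j)%:~R * u i (x j i)).
    by apply: eq_bigr => j _; rewrite (fu (SigSub (xS j)))/= mulr_sumr.
  by rewrite exchange_big/=; apply: big1.
rewrite (bigD1 j0)//= big1 ?addr0 => [|j jj0]; last first.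
  by rewrite indicE memNset ?mulr0// => /xinj/eqP; rewrite (negPf jj0).
rewrite indicE mem_set// mulr1 => /eqP.
by rewrite intr_eq0 (negPf (p0 j0)).
Qed.

Lemma good_of_no_loop (R : realType) (n : nat) (X : 'I_n -> Type)
    (S : set (forall i, X i)) :
  (forall L, L `<=` S -> ~ loop L) -> good R S.
Proof.
move=> noloop f.
(* [f] is extended by 0 off [S], so that [v] is defined at every point. *)
pose f' x : R := oapp f 0 (insub x).
(* The coordinate [None] carries the prescribed value: a functional that kills every
   [v x], x in S, and is 1 at [e] sends the sum of the deltas to - f x. *)
pose v x : option {i & X i} -> R^o := fun o =>
  match o with Some (existT i y) => \1_[set x i] y | None => f' x end.
(* Lists may repeat points, so that a sum of combinations is a concatenation; repetitions are merged
   afterwards. *)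
pose lc (r : seq (R * forall i, X i)) := \sum_(z <- r) z.1 *: v z.2.
pose A := [set w | exists2 r, all (fun z => z.2 \in S) r & w = lc r].
pose e : option {i & X i} -> R^o := \1_[set None].
have A0 : A 0 by exists [::]; rewrite // /lc big_nil.
have Alin a w w' : A w -> A w' -> A (a *: w + w').
  move=> [r rS ->] [r' r'S ->]; exists ([seq (a * z.1, z.2) | z <- r] ++ r').
    by rewrite all_cat all_map r'S andbT.
  rewrite /lc big_cat big_map scaler_sumr; congr (_ + _).
  by apply: eq_bigr => z _; rewrite scalerA.
(* If [e] were such a combination, its [Some] coordinates would give a dependence between the sums
   of deltas, nontrivial because the [None] coordinate is 1. That dependence would produce a loop
   inside [S]. *)
have Ae : ~ A e.
  move=> [r rS]; have [m [y [yinj yr /(_ _ v) E]]] := collect_fibers r.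
  rewrite /lc {}E; set c := fun l : 'I_m => \sum_(z <- r) z.1 * \1_[set z.2] (y l).
  rewrite fct_sumE => /funeqP ey.
  have [l cl] : exists l, c l != 0.
    apply: contrapT => /forallNP c0; have := ey None.
    rewrite /e indicE mem_set// big1 => [/eqP|l _]; first by rewrite oner_eq0.
    by have /negP := c0 l; rewrite negbK -/(c l) => /eqP ->; rewrite scale0r.
  have [i z|M [M0 My Mb]] := balanced_of_dependence yinj cl.
    by have := ey (Some (existT _ i z)); rewrite /e indicE memNset.
  have [L LM] := loop_of_balanced M0 Mb; apply: noloop => x /LM/My[j _ <-].
  have [i ->] := yr j; apply: set_mem; exact: (elimT (all_tnthP (t := in_tuple r)) rS i).
have [h [he hA]] := separating_functional A0 Alin Ae.
exists (fun i y => - h (\1_[set Some (existT _ i y)])) => x.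
have vx : v (val x) = f x *: e + \sum_i (\1_[set Some (existT _ i (val x i))] : _ -> R^o).
  apply/funext => -[[i y]|]; rewrite addrfctE scalrfctE fct_sumE /e /=.
    rewrite [\1_[set None] _]indicE memNset// scaler0 add0r (bigD1 i)//=.
    rewrite big1 ?addr0 => [|i' i'i].
      rewrite !indicE; congr ((_ : bool)%:R).
      apply/idP/idP => [/set_mem ->|/set_mem]; first exact/mem_set.
      by case=> /(@eq_from_Tagged _ X _ _ _) ->; exact/mem_set.
    by rewrite indicE memNset// => -[] ii'; rewrite ii' eqxx in i'i.
  rewrite indicE mem_set// /f' valK /= big1 ?addr0 => [|i _].
    by rewrite [RHS]mulr1.
  by rewrite indicE memNset.
have : h (v (val x)) = 0.
  apply: hA; exists [:: (1, val x)]; first by rewrite /= andbT (valP x).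
  by rewrite /lc big_seq1 scale1r.
rewrite vx linearP he mulr1 linear_sum sumrN => /eqP.
by rewrite addr_eq0 => /eqP.
Qed.

Theorem theorem1p2 (R : realType) (n : nat) (hn : (1 <= n)%N)
    (X : 'I_n -> Type) (hX : forall i, inhabited (X i))
    (S : set (forall i, X i)) :
  good R S <-> ~ (exists L : set (forall i, X i), L `<=` S /\ loop L).
Proof.
split=> [gS [L [LS Lloop]]|noloop]; first exact: loop_not_good Lloop gS.
by apply: good_of_no_loop => L LS Lloop; apply: noloop; exists L.
Qed.
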